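(* For every $n\ge 1$, $$|E(\mathrm{Dom}_{T_n}(D_n))|=\sum_{k=1}^{n}k^{\,n-k}\binom{n-1}{k-1}.$$
   Context: $X_n=\{1,2,\dots,n\}$ is the finite chain with its usual order, and $T_n$ is the full transformation semigroup of all maps $X_n\to X_n$, written on the right and composed left to right. $D_n=\{\alpha\in T_n: x\alpha\le x \text{ for all } x\in X_n\}$ is the subsemigroup of order-decreasing maps. For a subsemigroup $U$ of a semigroup $S$, an element $d\in S$ is dominated by $U$ if for every semigroup $T$ and all semigroup homomorphisms $f,g:S\to T$ with $f|_U=g|_U$ one has $(d)f=(d)g$; the dominion $\mathrm{Dom}_S(U)$ is the set of all elements of $S$ dominated by $U$ (a subsemigroup of $S$ containing $U$). $E(S)$ denotes the set of idempotents of a semigroup $S$. *)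

(* Defs.v *)
From HB Require Import structures.
From mathcomp Require Import all_boot.
From mathcomp Require Import boolp classical_sets.

Set Implicit Arguments.
Unset Strict Implicit.
Unset Printing Implicit Defensive.

Local Open Scope classical_set_scope.
Local Open Scope group_scope.

(* The chain X_n = {1 < ... < n} is represented by 'I_n = {0 < ... < n-1}. *)
Definition transf (n : nat) : Type := {ffun 'I_n -> 'I_n}.

HB.instance Definition _ n := Finite.copy (transf n) {ffun 'I_n -> 'I_n}.

(* Maps act on the right: x (a * b) = (x a) b. *)
Definition transf_mul n (a b : transf n) : transf n := [ffun x => b (a x)].

Lemma transf_mulA n : associative (@transf_mul n).
Proof. by move=> a b c; apply/ffunP => x; rewrite !ffunE. Qed.

HB.instance Definition _ n := isSemigroup.Build (transf n) (@transf_mulA n).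

Definition order_decreasing n : set (transf n) :=
  [set a : transf n | forall x : 'I_n, (a x <= x)%N].

Lemma order_decreasingM n (a b : transf n) :
  order_decreasing a -> order_decreasing b -> order_decreasing (a * b).
Proof. by move=> da db x; rewrite ffunE (leq_trans (db _)). Qed.

(* The library's semigroupType includes a choiceType structure on the carrier.
   This does not restrict the range of T below: by the axioms of boolp every
   type carries one. *)
Definition dominion (S : semigroupType) (U : set S) : set S :=
  [set d : S | forall (T : semigroupType) (f g : {multiplicative S -> T}),
     {in U, f =1 g} -> f d = g d].

Definition idempotents (S : semigroupType) (A : set S) : set S :=
  [set e : S | A e /\ e * e = e].

(* Main.v *)
(* The idempotents of the dominion turn out to be the idempotents of T_n fixing
   the least point 0.

   An element d moving 0 is separated from D_n by two actions of T_n on pairs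
   (h, c), with h a predicate on X_n and c a bit: a sends (h, c) to (h o a, c),
   respectively to (h o a, c + h 0 + h (0 a)); the two agree exactly at the maps
   fixing 0.

   Conversely, let e be an idempotent fixing 0, let m send z to the least point
   of its e-class, and let u be m on the image of e and 0 elsewhere.  Then m, u
   and u e are order-decreasing, m = e u and e = m e, so Isbell's zigzag
     e = m e,  m = e u,  e (u e) = e
   puts e in the dominion.

   Finally, an idempotent with fixed-point set B is an arbitrary map from the
   complement of B to B. *)
Require Import Defs.
From HB Require Import structures.
From mathcomp Require Import all_boot.
From mathcomp Require Import boolp classical_sets.

Set Implicit Arguments.
Unset Strict Implicit.
Unset Printing Implicit Defensive.

(** Swap [f] for [g] at [m], [g] for [f] at [u], and [f] for [g] at [w]: f e = f m f e = g m f e = g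
    e g u f e = g e f w = g e g w = g (m e) = g e. *)
Lemma dominion_zigzag (S : semigroupType) (U : set S) (e m u w : S) :
  U m -> U u -> U w -> m = (e * u)%g -> w = (u * e)%g -> e = (m * e)%g ->
  dominion U e.
Proof.
move=> Um Uu Uw mE wE eE T f g fg.
have agree x : U x -> f x = g x by move=> Ux; apply: fg; rewrite in_setE.
rewrite [in LHS]eE gmulfM agree // mE gmulfM -mulgA -(agree _ Uu) -gmulfM -wE.
by rewrite (agree _ Uw) -gmulfM wE mulgA -mE -eE.
Qed.

Lemma dominion_idempotent n (x0 : 'I_n) (e : transf n) :
  x0 = 0%N :> nat -> (e * e)%g = e -> e x0 = x0 ->
  dominion (@order_decreasing n) e.
Proof.
move=> x00 ee e0.
have eK x : e (e x) = e x by rewrite -[in RHS]ee ffunE.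
pose low z := [arg min_(w < z | e w == e z) (w : nat)].
have e_low z : e (low z) = e z by rewrite /low; case: arg_minnP => // w /eqP.
have low_le z w : e w = e z -> (low z <= w)%N.
  by rewrite /low; case: arg_minnP => // v _ min_v /eqP; apply: min_v.
have low_e z : low (e z) = low z.
  apply/val_inj/eqP; rewrite eqn_leq !low_le //; first by rewrite e_low eK.
  by rewrite e_low eK.
pose m : transf n := [ffun z => low z].
(* The default [x0] is least and fixed by [e], so off the image of [e] both [u] and [u * e] stay
   order-decreasing. *)
pose u : transf n := [ffun z => if e z == z then low z else x0].
apply: (@dominion_zigzag _ _ e m u (u * e)%g) => //.
- by move=> x; rewrite ffunE low_le.
- by move=> x; rewrite ffunE; case: ifP; rewrite ?low_le // x00.
- move=> x; rewrite !ffunE; case: ifP => [/eqP ex|_]; last by rewrite e0 x00.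
  by rewrite e_low ex.
- by apply/ffunP => x; rewrite !ffunE eK eqxx low_e.
- by apply/ffunP => x; rewrite !ffunE e_low.
Qed.

Definition endofun (V : finType) : Type := {ffun V -> V}.

HB.instance Definition _ V := Choice.copy (endofun V) {ffun V -> V}.

(** The order is opposite to that of [transf_mul]: pulling predicates back along maps reverses
    composition, so [precomp] becomes multiplicative. *)
Definition endofun_comp (V : finType) (u v : endofun V) : endofun V :=
  [ffun h => u (v h)].

Lemma endofun_compA V : associative (@endofun_comp V).
Proof. by move=> a b c; apply/ffunP => x; rewrite !ffunE. Qed.

HB.instance Definition _ V :=
  isSemigroup.Build (endofun V) (@endofun_compA V).

Section Separation.

Variables (n : nat) (x0 : 'I_n).

Local Notation state := ({ffun 'I_n -> bool} * bool)%type.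

Definition precomp (a : transf n) : endofun state :=
  [ffun hc : state => ([ffun x => hc.1 (a x)], hc.2)].

Definition twisted_precomp (a : transf n) : endofun state :=
  [ffun hc : state => ([ffun x => hc.1 (a x)], hc.2 (+) (hc.1 x0 (+) hc.1 (a x0)))].

Lemma precompM : {morph precomp : a b / (a * b)%g}.
Proof.
move=> a b; apply/ffunP => -[h c]; rewrite !ffunE; congr pair.
by apply/ffunP => x; rewrite !ffunE.
Qed.

(** The two copies of h (b x0) cancel; in fact the twist is [precomp] conjugated by the involution
    (h, c) -> (h, c + h x0). *)
Lemma twisted_precompM : {morph twisted_precomp : a b / (a * b)%g}.
Proof.
move=> a b; apply/ffunP => -[h c]; rewrite !ffunE; congr pair => /=.
  by apply/ffunP => x; rewrite !ffunE.
by rewrite -[RHS]addbA -(addbA (h x0)) addKb.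
Qed.

HB.instance Definition _ :=
  isMultiplicative.Build (transf n) (endofun state) precomp precompM.

HB.instance Definition _ :=
  isMultiplicative.Build (transf n) (endofun state) twisted_precomp
    twisted_precompM.

Lemma eq_twisted_precomp a : precomp a = twisted_precomp a <-> a x0 = x0.
Proof.
(* The indicator of [x0] detects whether [a] moves [x0]. *)
split=> [/ffunP/(_ ([ffun x => x == x0], false)) | ax0].
  by rewrite !ffunE => -[]; rewrite eqxx; case: eqP.
by apply/ffunP => -[h c]; rewrite !ffunE ax0 addbb addbF.
Qed.

Lemma dominion_fix (U : set (transf n)) (d : transf n) :
  (forall a, U a -> a x0 = x0) -> dominion U d -> d x0 = x0.
Proof.
move=> Ufix /(_ _ precomp twisted_precomp) eq_d.
apply/eq_twisted_precomp/eq_d => a; rewrite in_setE => Ua.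
exact/eq_twisted_precomp/Ufix.
Qed.

End Separation.

Section Counting.

Variable T : finType.
Implicit Types (B : {set T}) (e : {ffun T -> T}).

Definition fixset e : {set T} := [set x | e x == x].

Lemma card_idempotent_fixset B :
  #|[set e : {ffun T -> T} | [forall x, e (e x) == e x] & fixset e == B]| =
  #|B| ^ (#|T| - #|B|).
Proof.
pose F x : {pred T} := if x \in B then mem (pred1 x) else mem B.
transitivity #|family F|.
  apply: eq_card => e; rewrite inE.
  apply/andP/familyP => [[/forallP ee /eqP eB] x | eF].
    by rewrite /F -eB inE; case: ifP => // _; rewrite inE.
  have fixB x : x \in B -> e x = x.
    by move=> xB; have := eF x; rewrite /F xB => /eqP.
  have eB x : e x \in B.
    by have := eF x; rewrite /F; case: ifP => // xB _; rewrite fixB.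
  split; first by apply/forallP => x; rewrite fixB.
  by apply/eqP/setP => x; rewrite inE; apply/eqP/idP => [<- //|]; apply: fixB.
rewrite card_family foldrE big_map big_enum /=.
have <- : #|~: B| = (#|T| - #|B|)%N by rewrite cardsCs finset.setCK.
rewrite -prod_nat_const [RHS]big_mkcond; apply: eq_bigr => x _.
by rewrite inE /F; case: ifP => //= _; rewrite card1.
Qed.

(** Pascal's rule: adding the sets of size [k.+1] that avoid [x0] gives all sets of that size. *)
Lemma card_sets_containing (x0 : T) k :
  #|[set B : {set T} | x0 \in B & #|B| == k.+1]| = 'C(#|T|.-1, k).
Proof.
have T_gt0 : (0 < #|T|)%N by apply/card_gt0P; exists x0.
apply: (@addnI 'C(#|T|.-1, k.+1)).
rewrite -binS prednK // -card_draws.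
rewrite -[RHS](cardsID [set B : {set T} | x0 \in B]) addnC; congr addn.
  by apply: eq_card => B; rewrite !inE andbC.
rewrite -(cardsC1 x0) -cards_draws; apply: eq_card => B.
by rewrite !inE finset.subsetC finset.sub1set inE.
Qed.

Lemma card_idempotent_fix (x0 : T) :
  #|[set e : {ffun T -> T} | [forall x, e (e x) == e x] & e x0 == x0]| =
  (\sum_(1 <= k < #|T|.+1) k ^ (#|T| - k) * 'C(#|T|.-1, k.-1))%N.
Proof.
rewrite -sum1_card (partition_big fixset (fun B => x0 \in B)) /=; last first.
  by move=> e; rewrite !inE => /andP[].
transitivity (\sum_(B : {set T} | x0 \in B) #|B| ^ (#|T| - #|B|))%N.
  (* Once [x0] lies in the fixed-point set [B], the condition on [e x0] is automatic. *)
  apply: eq_bigr => B x0B; rewrite -card_idempotent_fixset -sum1_card.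
  apply: eq_bigl => e; rewrite !inE -andbA; congr andb.
  by case: (fixset e =P B) x0B => [<-|]; rewrite ?andbF // inE => ->.
have card_ord_set B : (#|B| < #|T|.+1)%N by rewrite ltnS max_card.
rewrite (partition_big (fun B => Ordinal (card_ord_set B)) predT) //=.
rewrite -(big_mkord predT (fun k =>
  \sum_(B : {set T} | (x0 \in B) && (#|B| == k)) #|B| ^ (#|T| - #|B|)))%N.
(* The term k = 0 vanishes, since no set containing [x0] is empty. *)
rewrite [LHS]big_ltn_cond //= big1 ?add0n => [|B /andP[x0B /eqP/cards0_eq B0]]; last first.
  by rewrite B0 inE in x0B.
apply: eq_big_nat => -[//|k] _.
rewrite -(card_sets_containing x0) mulnC -sum_nat_const.
by apply: eq_big => [B|B /andP[_ /eqP->]]; rewrite ?inE.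
Qed.

End Counting.

Theorem lemma2p8 (n : nat) (hn : (1 <= n)%N) :
  #|idempotents (dominion (@order_decreasing n))| =
  (\sum_(1 <= k < n.+1) k ^ (n - k) * 'C(n.-1, k.-1))%N.
Proof.
pose x0 : 'I_n := Ordinal hn.
have := card_idempotent_fix x0; rewrite !card_ord => <-.
apply: eq_card => e; rewrite inE; apply/idP/andP
  => [|[/forallP ee /eqP e0]].
  rewrite in_setE => -[de ee]; split.
    by apply/forallP => x; rewrite -[in X in _ == X]ee ffunE.
  apply/eqP; apply: dominion_fix de => a /(_ x0); rewrite leqn0 => /eqP ax0.
  exact: val_inj.
have ee' : (e * e)%g = e :> transf n.
  by apply/ffunP => x; rewrite ffunE; apply/eqP.
by rewrite in_setE; split=> //; apply: dominion_idempotent e0.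
Qed.
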